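(* Let $G$ be a simple graph of order $n\ge 2$ with adjacency eigenvalues $\lambda_1\ge\lambda_2\ge\cdots\ge\lambda_n$ and let $\boldsymbol{\lambda}=(\lambda_1,\dots,\lambda_n)$. Let $\boldsymbol{w}\in\mathbb{R}^n$ be $\boldsymbol{w}=(1,\dots,1,-1,\dots,-1)$ (with $n/2$ entries of each sign) if $n$ is even, and $\boldsymbol{w}=(1,\dots,1,0,-1,\dots,-1)$ (with $(n-1)/2$ entries of each sign) if $n$ is odd. Then $$\beta\,\boldsymbol{w}\;\prec\;\boldsymbol{\lambda}\;\prec\;\lambda_1\,\boldsymbol{w},$$ where $$\beta:=\begin{cases}\dfrac{2}{n}\displaystyle\sum_{j=1}^{n/2}\lambda_j & \text{if } n \text{ is even},\\[2mm] \dfrac{2}{n-1}\displaystyle\sum_{j=1}^{(n-1)/2}\lambda_j+\dfrac{2}{n-1}\min\bigl\{0,\lambda_{(n+1)/2}\bigr\} & \text{if } n \text{ is odd}.\end{cases}$$ Moreover, if $G$ is bipartite, then $\beta=\frac{1}{2\lfloor n/2\rfloor}\|G\|_\ast$ and $$\frac{\|G\|_\ast}{2\lfloor n/2\rfloor}\,\boldsymbol{w}\;\prec\;\boldsymbol{\lambda}\;\prec\;\lambda_1\,\boldsymbol{w}.$$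
   Context: The eigenvalues of a graph are those of its adjacency matrix. The energy of $G$ is $\|G\|_\ast=|\lambda_1|+\cdots+|\lambda_n|$. For $\boldsymbol{x},\boldsymbol{y}\in\mathbb{R}^n$, $\boldsymbol{x}\prec\boldsymbol{y}$ ($\boldsymbol{x}$ is majorized by $\boldsymbol{y}$) means $\sum_{j=1}^k x_j^{\downarrow}\le\sum_{j=1}^k y_j^{\downarrow}$ for $k=1,\dots,n$, with equality for $k=n$, where $\boldsymbol{x}^{\downarrow}$ is the decreasing rearrangement of $\boldsymbol{x}$. *)

(* Defs.v *)
From HB Require Import structures.
From mathcomp Require Import all_boot all_order all_algebra.
From mathcomp Require Import polyrcf.

Set Implicit Arguments.
Unset Strict Implicit.
Unset Printing Implicit Defensive.

Import Order.TTheory GRing.Theory Num.Theory.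
Local Open Scope ring_scope.

Record sgraph (V : finType) := SGraph {
  adj :> rel V;
  adj_sym : symmetric adj;
  adj_irrefl : irreflexive adj
}.

Definition bipartite (V : finType) (G : sgraph V) : Prop :=
  exists A : {set V}, forall x y, G x y -> (x \in A) != (y \in A).

Section Majorization.
Variable R : realDomainType.

Definition decreasing_rearrangement n (x : 'rV[R]_n) : seq R :=
  sort >=%R [seq x 0 i | i <- enum 'I_n].

Definition majorized n (x y : 'rV[R]_n) : Prop :=
  (forall k : nat, (1 <= k <= n)%N ->
     \sum_(j < k) (decreasing_rearrangement x)`_j
       <= \sum_(j < k) (decreasing_rearrangement y)`_j) /\
  \sum_(j < n) (decreasing_rearrangement x)`_j
    = \sum_(j < n) (decreasing_rearrangement y)`_j.

Definition sign_vector n : 'rV[R]_n :=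
  \row_(i < n) (if (i < n./2)%N then 1
                else if (i < n - n./2)%N then 0 else -1).

End Majorization.

Arguments sign_vector : clear implicits.

Section Spectrum.
Variable R : rcfType.

(* All eigenvalues of A lying in R, repeated according to their algebraic
   multiplicity, in decreasing order.  [rootsR] has no repetitions; for a
   symmetric A the list has n elements, by the spectral theorem. *)
Definition eigenvalues n (A : 'M[R]_n) : seq R :=
  sort >=%R
    (flatten [seq nseq (mup a (char_poly A)) a | a <- rootsR (char_poly A)]).

Variables (V : finType) (G : sgraph V).

Definition adjacency_matrix : 'M[R]_#|V| :=
  \matrix_(i, j) (G (enum_val i) (enum_val j))%:R.

(* Indexed from 1: [lambda 1] is the largest eigenvalue. *)
Definition lambda (j : nat) : R := (eigenvalues adjacency_matrix)`_j.-1.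

Definition lambda_vector : 'rV[R]_#|V| := \row_(i < #|V|) lambda i.+1.

Definition energy : R := \sum_(1 <= j < #|V|.+1) `|lambda j|.

Definition beta : R :=
  let n := #|V| in
  if odd n then
    2 / (n - 1)%:R * \sum_(1 <= j < ((n - 1)./2).+1) lambda j
    + 2 / (n - 1)%:R * Num.min 0 (lambda ((n + 1)./2))
  else
    2 / n%:R * \sum_(1 <= j < (n./2).+1) lambda j.

End Spectrum.

Arguments adjacency_matrix R {V} G.
Arguments lambda R {V} G j.
Arguments lambda_vector R {V} G.
Arguments energy R {V} G.
Arguments beta R {V} G.

(* Main.v *)
Require Import Defs.
From mathcomp Require Import all_boot all_order all_algebra.
From mathcomp Require Import polyrcf complex.
From mathcomp Require Import ring lra zify.

(** Put [m = n./2] and [S_k = lambda_1 + ... + lambda_k], so that [S_0 = 0] and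
    [S_n = 0] (the trace).  The partial sums of the sign vector are
    [min(k, n - k)], so the two majorizations say that
    [beta * min(k, n - k) <= S_k <= lambda_1 * min(k, n - k)].

    Upper bound: [|lambda_j| <= lambda_1] because the adjacency matrix has
    nonnegative entries ([nonneg_eigenvalue_bound]); bound [S_k] by its [k]
    terms, or minus the sum of the [n - k] remaining ones.

    Lower bound: the case distinction in the definition of [beta] amounts to
    [beta * m = min(S_m, S_(n-m))] ([betaE]).  As the eigenvalues decrease,
    [S] is a concave function of [k], hence lies above its chords from [0] to
    [m] and from [n - m] to [n] ([prefix_average]).

    The right half of the range of [k] is always reduced to the left half by
    the reversal [j |-> - lambda_(n+1-j)], which is again decreasing and has
    the partial sums [S_(n-k)] ([suffix_prefix]).  For a bipartite graph,
    changing the signs on one side of the bipartition conjugates [A] to [- A],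
    so this reversal fixes the spectrum; then [S_m = S_(n-m)] and the energy is
    [S_m + S_(n-m)].

    The spectral facts over a real closed field [R] come from the unitary
    diagonalization of Hermitian matrices over [R[i]] ([real_spectral]). *)

Set Implicit Arguments.
Unset Strict Implicit.
Unset Printing Implicit Defensive.

Import Order.TTheory GRing.Theory Num.Theory.
Local Open Scope ring_scope.

(** * Partial sums of decreasing sequences *)

Section PartialSums.
Variable R : realFieldType.
Implicit Types (f g : nat -> R) (n m k : nat) (b c : R).

(** The coordinates of [sign_vector R n] as a function on [nat], so that its
    partial sums and those of a spectrum have the same form. *)
Definition sign_entry n j : R :=
  if (j < n./2)%N then 1 else if (j < n - n./2)%N then 0 else -1.

Lemma sum_sign_entry n k : (k <= n)%N ->
  \sum_(j < k) sign_entry n j = (minn k (n - k))%:R.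
Proof.
have n2 := odd_double_half n.
elim: k => [|k IHk] lekn; first by rewrite big_ord0 min0n.
rewrite big_ord_recr /= IHk ?(ltnW lekn) // /sign_entry.
case: ltnP => [lt_k|ge_k].
  by rewrite -[1]/(1%:R) -natrD; congr (_%:R); lia.
case: ltnP => [lt_k'|ge_k'].
  by rewrite addr0; congr (_%:R); lia.
by apply/eqP; rewrite subr_eq -[1]/(1%:R) -natrD; apply/eqP; congr (_%:R); lia.
Qed.

(** The partial sums of a decreasing sequence are concave in their length:
    averages over longer prefixes are smaller.  Once the common part of both
    sides is cancelled, [k] times the terms from [k] on is compared with
    [m - k] times the terms before [k], and [f k] separates the two. *)
Lemma prefix_average f m k :
  (forall i j, (i <= j < m)%N -> f j <= f i) -> (k <= m)%N ->
  (\sum_(j < m) f j) *+ k <= (\sum_(j < k) f j) *+ m.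
Proof.
move=> f_dec; rewrite leq_eqVlt => /predU1P[->//|ltkm].
have headP : f k *+ k <= \sum_(j < k) f j.
  rewrite -[k in _ *+ k]card_ord -sumr_const; apply: ler_sum => j _.
  by apply: f_dec; have := ltn_ord j; lia.
have tailP : \sum_(k <= j < m) f j <= f k *+ (m - k).
  rewrite -sumr_const_nat big_nat_cond [leRHS]big_nat_cond.
  by apply: ler_sum => j /andP[jkm _]; apply: f_dec; lia.
rewrite -(big_mkord xpredT f) (big_cat_nat (leq0n k) (ltnW ltkm)) /= big_mkord.
rewrite -[in leRHS](subnKC (ltnW ltkm)) mulrnDr mulrnDl lerD2l.
apply: (@le_trans _ _ ((f k *+ (m - k)) *+ k)); first by rewrite lerMn2r tailP orbT.
by rewrite -mulrnA mulnC mulrnA lerMn2r headP orbT.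
Qed.

(** The reversal [j |-> - f (n - j.+1)] preserves monotonicity and the bounds on
    [`|f|], so a bound on short prefixes, applied to it, becomes a bound on the
    prefixes of length at least [n / 2]. *)
Lemma suffix_prefix f n k : (k <= n)%N -> \sum_(j < n) f j = 0 ->
  \sum_(j < k) - f (n - j.+1)%N = \sum_(j < n - k) f j.
Proof.
move=> lekn; rewrite -(big_mkord xpredT f) (big_cat_nat (leq0n (n - k)) (leq_subr _ _)) /=.
rewrite !big_mkord => /eqP; rewrite addr_eq0 => /eqP ->.
rewrite -sumrN big_nat_rev /= -{1}[(n - k)%N]add0n big_addn (subKn lekn) big_mkord.
by apply: eq_bigr => j _; congr (- f _); have := ltn_ord j; lia.
Qed.

(** Concavity puts the partial sums above the chord from [0] to [n./2], of slope
    at least [b]; the reversed sequence treats the other end. *)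
Lemma prefix_sum_lower f n b k : (1 < n)%N ->
  (forall i j, (i <= j < n)%N -> f j <= f i) -> \sum_(j < n) f j = 0 ->
  b *+ n./2 <= \sum_(j < n./2) f j -> b *+ n./2 <= \sum_(j < n - n./2) f j ->
  (k <= n)%N -> b * (minn k (n - k))%:R <= \sum_(j < k) f j.
Proof.
move=> n_gt1 f_dec f_sum0 b_head b_tail le_kn.
have m_gt0 : (0 < n./2)%N by lia.
suff half g : (forall i j, (i <= j < n./2)%N -> g j <= g i) ->
    forall p, (p <= n./2)%N -> b *+ n./2 <= \sum_(j < n./2) g j ->
    b *+ p <= \sum_(j < p) g j.
  rewrite mulr_natr; case: leqP => le_k.
    by apply: half => // [i j ij|]; [apply: f_dec; lia | lia].
  have := suffix_prefix (leq_subr k n) f_sum0; rewrite (subKn le_kn) => <-.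
  apply: (half (fun j => - f (n - j.+1)%N)); last 2 first.
  - by lia.
  - by rewrite suffix_prefix //; lia.
  by move=> i j ij; rewrite lerN2; apply: f_dec; lia.
move=> g_dec p le_p b_le; have le_gp := prefix_average g_dec le_p.
have : b *+ n./2 *+ p <= (\sum_(j < p) g j) *+ n./2.
  by apply: le_trans le_gp; rewrite lerMn2r b_le orbT.
by rewrite mulrnAC lerMn2r eqn0Ngt m_gt0.
Qed.

Lemma prefix_sum_upper f n c k :
  (forall j, (j < n)%N -> `|f j| <= c) -> \sum_(j < n) f j = 0 ->
  (k <= n)%N -> \sum_(j < k) f j <= c * (minn k (n - k))%:R.
Proof.
move=> f_bd f_sum0 le_kn.
have bound g p : (forall j, (j < p)%N -> g j <= c) -> \sum_(j < p) g j <= c *+ p.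
  move=> g_bd; rewrite -[p in _ *+ p]card_ord -sumr_const.
  by apply: ler_sum => j _; apply: g_bd.
rewrite mulr_natr; case: leqP => _.
  by apply: bound => j jk; apply: le_trans (ler_norm _) (f_bd _ _); lia.
have := suffix_prefix (leq_subr k n) f_sum0; rewrite (subKn le_kn) => <-.
apply: (bound (fun j => - f (n - j.+1)%N)) => j jk.
by apply: le_trans (ler_norm _) _; rewrite normrN; apply: f_bd; lia.
Qed.

Lemma decreasing_rearrangement_row f n :
  (forall i j, (i <= j < n)%N -> f j <= f i) ->
  decreasing_rearrangement (\row_(i < n) f i) = mkseq f n.
Proof.
move=> f_dec; rewrite /decreasing_rearrangement.
have -> : [seq (\row_(i < n) f i) 0 i | i <- enum 'I_n] = mkseq f n.
  by rewrite /mkseq -val_enum_ord -map_comp; apply: eq_map => i /=; rewrite mxE.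
apply: sorted_sort; first exact: ge_trans.
apply/(sortedP 0) => i; rewrite size_mkseq => lt_in.
by rewrite !nth_mkseq ?(ltnW lt_in) //; apply: f_dec; lia.
Qed.

Lemma majorized_rows f g n :
  (forall i j, (i <= j < n)%N -> f j <= f i) ->
  (forall i j, (i <= j < n)%N -> g j <= g i) ->
  (forall k, (k <= n)%N -> \sum_(j < k) f j <= \sum_(j < k) g j) ->
  \sum_(j < n) f j = \sum_(j < n) g j ->
  majorized (\row_(i < n) f i) (\row_(i < n) g i).
Proof.
move=> f_dec g_dec le_fg eq_fg.
rewrite /majorized !decreasing_rearrangement_row //.
have nthE h k : (k <= n)%N -> \sum_(j < k) (mkseq h n)`_j = \sum_(j < k) h j.
  by move=> le_kn; apply: eq_bigr => j _; rewrite nth_mkseq //; have := ltn_ord j; lia.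
by split=> [k /andP[_ le_kn]|]; rewrite !nthE //; apply: le_fg.
Qed.

Lemma sign_entry_decreasing n i j : (i <= j < n)%N ->
  sign_entry n j <= sign_entry n i.
Proof.
rewrite /sign_entry => ij.
by do 4 ?case: ltnP => ?; rewrite ?lexx //; try lia; lra.
Qed.

Lemma scaled_sign_vectorE n b :
  b *: sign_vector R n = \row_(i < n) (b * sign_entry n i).
Proof. by apply/rowP => i; rewrite !mxE. Qed.

(** The hypothesis on [b] gives both chord bounds of [prefix_sum_lower], and
    also [0 <= b]: without it, [b *: sign_vector R n] would not be listed in
    decreasing order. *)
Lemma sign_vector_majorized f n b : (1 < n)%N ->
  (forall i j, (i <= j < n)%N -> f j <= f i) -> \sum_(j < n) f j = 0 ->
  b *+ n./2 = Num.min (\sum_(j < n./2) f j) (\sum_(j < n - n./2) f j) ->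
  majorized (b *: sign_vector R n) (\row_(i < n) f i).
Proof.
move=> n_gt1 f_dec f_sum0 bE.
have prefix_ge0 k : (k <= n)%N -> 0 <= \sum_(j < k) f j.
  move=> le_kn; have := prefix_average f_dec le_kn.
  by rewrite f_sum0 mul0rn pmulrn_lge0 //; lia.
have b_ge0 : 0 <= b.
  have m_gt0 : (0 < n./2)%N by lia.
  by rewrite -(pmulrn_lge0 _ m_gt0) bE le_min !prefix_ge0 //; lia.
rewrite scaled_sign_vectorE.
apply: (majorized_rows (f := fun j => b * sign_entry n j)) => //.
- by move=> i j ij; apply: ler_wpM2l b_ge0 _ _ _; exact: sign_entry_decreasing ij.
- move=> k le_kn; rewrite -mulr_sumr sum_sign_entry //.
  by apply: prefix_sum_lower => //; rewrite bE ge_min lexx ?orbT.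
- by rewrite f_sum0 -mulr_sumr sum_sign_entry // subnn minn0 mulr0.
Qed.

Lemma majorized_sign_vector f n c :
  (forall i j, (i <= j < n)%N -> f j <= f i) -> \sum_(j < n) f j = 0 ->
  0 <= c -> (forall j, (j < n)%N -> `|f j| <= c) ->
  majorized (\row_(i < n) f i) (c *: sign_vector R n).
Proof.
move=> f_dec f_sum0 c_ge0 f_bd.
rewrite scaled_sign_vectorE.
apply: (majorized_rows (g := fun j => c * sign_entry n j)) => //.
- by move=> i j ij; apply: ler_wpM2l c_ge0 _ _ _; exact: sign_entry_decreasing ij.
- move=> k le_kn; rewrite -mulr_sumr sum_sign_entry //.
  exact: prefix_sum_upper.
- by rewrite f_sum0 -mulr_sumr sum_sign_entry // subnn minn0 mulr0.
Qed.

Lemma antisymmetric_prefix f n k :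
  (forall j, (j < n)%N -> f (n - j.+1)%N = - f j) -> \sum_(j < n) f j = 0 ->
  (k <= n)%N -> \sum_(j < n - k) f j = \sum_(j < k) f j.
Proof.
move=> f_anti f_sum0 le_kn; rewrite -suffix_prefix //; apply: eq_bigr => j _.
by rewrite f_anti ?opprK //; have := ltn_ord j; lia.
Qed.

(** The terms of index below [n - n./2] are at least their mirror image, which
    is their opposite, so they are nonnegative.  The terms from [n./2] on, read
    backwards, are the opposites of these. *)
Lemma antisymmetric_sum_norm f n :
  (forall i j, (i <= j < n)%N -> f j <= f i) ->
  (forall j, (j < n)%N -> f (n - j.+1)%N = - f j) ->
  \sum_(j < n) `|f j| = \sum_(j < n./2) f j + \sum_(j < n - n./2) f j.
Proof.
move=> f_dec f_anti.
have n2 := odd_double_half n.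
have f_ge0 j : (j < n - n./2)%N -> 0 <= f j.
  move=> lt_j; have := f_dec j (n - j.+1)%N; rewrite f_anti; last by lia.
  by move=> /(_ ltac:(lia)); lra.
rewrite -(big_mkord xpredT (fun j => `|f j|)) (big_cat_nat (leq0n n./2)) /=; last by lia.
rewrite big_mkord; congr (_ + _).
  by apply: eq_bigr => j _; rewrite ger0_norm // f_ge0 //; have := ltn_ord j; lia.
rewrite big_nat_rev /= -{1}[n./2]add0n big_addn big_mkord; apply: eq_bigr => j _.
have lt_j := ltn_ord j.
have -> : (n./2 + n - (j + n./2).+1 = n - j.+1)%N by lia.
by rewrite f_anti ?normrN ?ger0_norm ?f_ge0 //; lia.
Qed.

End PartialSums.

(** * Characteristic polynomials *)

Lemma char_poly_similar (F : fieldType) n (P B : 'M[F]_n) : P \in unitmx ->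
  char_poly (invmx P *m B *m P) = char_poly B.
Proof.
move=> Pu; rewrite /char_poly /char_poly_mx.
have -> : 'X%:M - map_mx polyC (invmx P *m B *m P) =
   map_mx polyC (invmx P) *m ('X%:M - map_mx polyC B) *m map_mx polyC P.
  rewrite mulmxBr mulmxBl -!map_mxM; congr (_ - _).
  by rewrite -mulmxA -scalar_mxC mulmxA -map_mxM mulVmx // map_mx1 mul1mx.
rewrite !det_mulmx mulrAC -det_mulmx -map_mxM mulVmx //.
by rewrite map_mx1 det1 mul1r.
Qed.

(** Substituting [- 'X] for ['X] in ['X%:M - A] gives [- ('X%:M - - A)]. *)
Lemma char_polyN (F : fieldType) n (A : 'M[F]_n) :
  char_poly (- A) = (-1) ^+ n *: (char_poly A \Po - 'X).
Proof.
rewrite /char_poly /char_poly_mx -[_ \Po _]/(comp_poly (- 'X) _).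
rewrite -(det_map_mx (comp_poly (- 'X))) -mul_polyC.
rewrite rmorphXn rmorphN /= -detZ; congr (\det _).
apply/matrixP => i j; rewrite !mxE /=.
rewrite comp_polyB comp_polyC rmorphMn /= comp_polyX polyCN.
by case: (i == j); rewrite ?mulr1n ?mulr0n; ring.
Qed.

Lemma char_polyN_roots (F : fieldType) n (A : 'M[F]_n) (s : seq F) :
  char_poly A = \prod_(a <- s) ('X - a%:P) ->
  char_poly (- A) = \prod_(a <- map -%R s) ('X - a%:P).
Proof.
move=> chiA; have szs : size s = n.
  by apply: succn_inj; rewrite -(size_char_poly A) chiA size_prod_XsubC.
rewrite char_polyN chiA rmorph_prod big_map /= -mul_polyC.
rewrite rmorphXn rmorphN /= -szs.
elim: s {chiA szs} => [|a s IHs]; first by rewrite !big_nil mulr1.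
rewrite !big_cons /= exprS -IHs comp_polyB comp_polyX comp_polyC polyCN; ring.
Qed.

(** Comparing lists by the number of occurrences of each [x]: in the list
    [eigenvalues A] it is the multiplicity of [x] as a root, since [rootsR]
    lists every root once; in [s] it is the same by the factorization. *)
Lemma eigenvalues_perm (R : rcfType) n (A : 'M[R]_n) (s : seq R) :
  char_poly A = \prod_(a <- s) ('X - a%:P) -> perm_eq (eigenvalues A) s.
Proof.
move=> chiA; have p0 : char_poly A != 0 by apply/monic_neq0/char_poly_monic.
rewrite /eigenvalues perm_sort; apply/allP => x _ /=; apply/eqP.
rewrite -(mu_prod_XsubC x s) -chiA count_flatten -map_comp.
rewrite sumnE big_map /=.
rewrite (eq_bigr (fun a => if a == x then mup x (char_poly A) else 0)%N); last first.
  by move=> a _; rewrite count_nseq /=; case: eqP => [->|_]; rewrite ?mul1n.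
rewrite -big_mkcond big_const_seq iter_addn_0.
rewrite count_uniq_mem ?uniq_roots //.
rewrite -(roots_on_rootsR p0 x) /=.
case: (boolP (root _ x)) => [_|/mupNroot ->]; first by rewrite muln1.
by rewrite muln0.
Qed.

(** * Spectra of real symmetric matrices *)

Section Spectrum.
Variable R : rcfType.
Local Open Scope complex_scope.

Local Notation conjC := (@Num.conj R[i]).
Local Notation toC := (real_complex R).

(** The spectral theorem without eigenvectors: if [A] is diagonalized by a
    unitary matrix [P] over [R[i]], the weights [y i] are the squared moduli of
    the coordinates of [x] in the orthonormal basis [P].  They are real, and so
    are the eigenvalues, whence a statement that only speaks of [R]. *)
Lemma real_spectral n (A : 'M[R]_n) : A^T = A ->
  exists d : 'I_n -> R,
    [/\ char_poly A = \prod_i ('X - (d i)%:P), \tr A = \sum_i d i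
      & forall x : 'rV_n, exists y : 'I_n -> R,
         [/\ forall i, 0 <= y i, (x *m A *m x^T) 0 0 = \sum_i d i * y i
           & (x *m x^T) 0 0 = \sum_i y i]].
Proof.
move=> symA; pose AC := map_mx toC A.
have herm : AC \is hermsymmx.
  apply: realsym_hermsym.
    by apply/is_hermitianmxP; rewrite expr0 scale1r map_mx_id // /AC map_trmx symA.
  by apply/mxOverP => i j; rewrite mxE; apply/complex_realP; exists (A i j).
have /orthomx_spectralP := hermitian_normalmx herm.
have := hermitian_spectral_diag_real herm.
have := spectral_unitarymx AC.
move: (spectralmx AC) (spectral_diag AC) => P D Pu /mxOverP Dreal ACE.
have Pun := unitarymx_unit Pu.
pose d i := complex.Re (D 0 i).
have dE i : toC (d i) = D 0 i by rewrite /d RRe_real.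
have toC_inj : injective toC by exact: complexI.
exists d; split.
- apply: (map_poly_inj toC); rewrite map_char_poly -/AC ACE char_poly_similar //.
  rewrite char_poly_trig ?diag_mx_is_trig // rmorph_prod; apply: eq_bigr => i _.
  by rewrite mxE eqxx mulr1n rmorphB /= map_polyX map_polyC -dE.
- apply: toC_inj; rewrite -trace_map_mx -/AC ACE mxtrace_mulC mulmxA mulmxV //.
  by rewrite mul1mx mxtrace_diag rmorph_sum; apply: eq_bigr => i _; rewrite -dE.
- move=> x; pose z := map_mx toC x *m invmx P.
  have zT : P *m (map_mx toC x)^T = map_mx conjC (z^T).
    rewrite /z trmx_mul map_mxM invmx_unitary // trmxCK; congr (_ *m _).
    by apply/matrixP => i j; rewrite !mxE /= (CrealP _) //; apply/complex_realP; eexists.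
  have zP : map_mx toC x = z *m P by rewrite mulmxKV.
  (* [z] is made opaque so that [mxE] does not expand it. *)
  clearbody z; pose y i := complex.Re (z 0 i * conjC (z 0 i)).
  have yE i : toC (y i) = z 0 i * conjC (z 0 i).
    by rewrite /y RRe_real // ger0_real // mul_conjC_ge0.
  exists y; split.
  + by move=> i; rewrite -ler0c [_%:C]yE mul_conjC_ge0.
  + apply: toC_inj; transitivity ((map_mx toC x *m AC *m (map_mx toC x)^T) 0 0).
      by rewrite map_trmx -!map_mxM [RHS]mxE.
    rewrite ACE !mulmxA -(mulmxA _ P) zT {1}zP mulmxK // !mxE rmorph_sum.
    apply: eq_bigr => i _; rewrite rmorphM /= dE yE mul_mx_diag !mxE.
    by rewrite mulrAC mulrC.
  + apply: toC_inj; transitivity ((map_mx toC x *m (map_mx toC x)^T) 0 0).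
      by rewrite map_trmx -!map_mxM [RHS]mxE.
    rewrite {1}zP -mulmxA zT !mxE rmorph_sum.
    by apply: eq_bigr => i _; rewrite !mxE -yE.
Qed.

Lemma eigenvalues_sorted n (A : 'M[R]_n) : sorted >=%R (eigenvalues A).
Proof. exact: sort_sorted (@ge_total _ _) _. Qed.

Lemma eigenvalues_roots n (A : 'M[R]_n) (s : seq R) :
  char_poly A = \prod_(a <- s) ('X - a%:P) -> eigenvalues A = sort >=%R s.
Proof.
move=> /eigenvalues_perm peq.
rewrite -[LHS](sorted_sort (@ge_trans _ _) (eigenvalues_sorted _)).
by apply/perm_sortP => //; [apply: ge_total | apply: ge_trans | apply: ge_anti].
Qed.

Section Symmetric.
Variables (n : nat) (A : 'M[R]_n).
Hypothesis A_sym : A^T = A.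

Lemma char_poly_eigenvalues :
  char_poly A = \prod_(a <- eigenvalues A) ('X - a%:P).
Proof.
have [d [chiA _ _]] := real_spectral A_sym.
rewrite -(big_map d xpredT (fun a => 'X - a%:P)) in chiA.
by rewrite (perm_big _ (eigenvalues_perm chiA)).
Qed.

Lemma size_eigenvalues : size (eigenvalues A) = n.
Proof.
by apply: succn_inj; rewrite -(size_char_poly A) char_poly_eigenvalues size_prod_XsubC.
Qed.

Lemma sum_eigenvalues : \sum_(a <- eigenvalues A) a = \tr A.
Proof.
have [d [chiA trA _]] := real_spectral A_sym.
rewrite -(big_map d xpredT (fun a => 'X - a%:P)) in chiA.
by rewrite (perm_big _ (eigenvalues_perm chiA)) big_map trA.
Qed.

Lemma eigenvalues_decreasing i j : (i <= j < n)%N ->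
  (eigenvalues A)`_j <= (eigenvalues A)`_i.
Proof.
move=> /andP[le_ij lt_jn].
apply: (sorted_leq_nth (@ge_trans _ _) (@ge_refl _ _) 0 (eigenvalues_sorted A)) => //.
  by rewrite inE size_eigenvalues (leq_ltn_trans le_ij).
by rewrite inE size_eigenvalues.
Qed.

Lemma rayleigh_bound (x : 'rV[R]_n) :
  (x *m A *m x^T) 0 0 <= (eigenvalues A)`_0 * (x *m x^T) 0 0.
Proof.
have [d [chiA _ /(_ x)[y [y_ge0 -> ->]]]] := real_spectral A_sym.
rewrite -(big_map d xpredT (fun a => 'X - a%:P)) in chiA.
rewrite mulr_sumr; apply: ler_sum => i _; apply: ler_wpM2r => //.
have : d i \in eigenvalues A.
  by rewrite (perm_mem (eigenvalues_perm chiA)) map_f // mem_index_enum.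
case/(nthP 0) => j; rewrite size_eigenvalues => lt_jn <-.
exact: eigenvalues_decreasing.
Qed.

(** The Perron-Frobenius bound: for an eigenvector [v], replacing its entries by
    their absolute values keeps [v *m v^T] and can only increase the modulus of
    [v *m A *m v^T], which is then at most the top eigenvalue times
    [v *m v^T]. *)
Lemma nonneg_eigenvalue_bound a : (forall i j, 0 <= A i j) ->
  a \in eigenvalues A -> `|a| <= (eigenvalues A)`_0.
Proof.
move=> A_ge0 /= a_eig.
have /eigenvalueP[v vA v_neq0] : eigenvalue A a.
  by rewrite eigenvalue_root_char char_poly_eigenvalues root_prod_XsubC.
pose u := map_mx Num.norm v.
have uu : (u *m u^T) 0 0 = (v *m v^T) 0 0.
  by rewrite !mxE; apply: eq_bigr => i _; rewrite !mxE -normrM ger0_norm // -expr2 sqr_ge0.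
have v_gt0 : 0 < (v *m v^T) 0 0.
  have /rV0Pn[i vi] := v_neq0.
  rewrite mxE (bigD1 i) //= ltr_wpDr ?mxE -?expr2 ?exprn_even_gt0 //.
  by apply: sumr_ge0 => j _; rewrite !mxE -expr2 sqr_ge0.
rewrite -(ler_pM2r v_gt0) -{2}uu; apply: le_trans (rayleigh_bound u).
have -> : `|a| * (v *m v^T) 0 0 = `|(v *m A *m v^T) 0 0|.
  by rewrite vA -scalemxAl [in RHS]mxE normrM (gtr0_norm v_gt0).
rewrite !mxE; apply: le_trans (ler_norm_sum _ _ _) _; apply: ler_sum => j _.
rewrite !mxE normrM ler_wpM2r //; apply: le_trans (ler_norm_sum _ _ _) _.
by apply: ler_sum => i _; rewrite !mxE normrM (ger0_norm (A_ge0 _ _)).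
Qed.

Lemma eigenvalues_antisymmetric j : char_poly (- A) = char_poly A ->
  (j < n)%N -> (eigenvalues A)`_(n - j.+1) = - (eigenvalues A)`_j.
Proof.
move=> chiN lt_jn.
have eigN : eigenvalues A = rev [seq - a | a <- eigenvalues A].
  have := char_polyN_roots char_poly_eigenvalues; rewrite chiN => /eigenvalues_roots.
  move=> {1}->; apply: (@sorted_eq _ >=%R).
  - exact: ge_trans.
  - exact: ge_anti.
  - exact: sort_sorted (@ge_total _ _) _.
  - rewrite rev_sorted sorted_map; apply: sub_sorted (eigenvalues_sorted A) => x y /=.
    by rewrite lerN2.
  - by rewrite perm_sort perm_sym perm_rev.
rewrite {1}eigN nth_rev ?size_map size_eigenvalues; last by lia.
rewrite (nth_map 0) ?size_eigenvalues; last by lia.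
by congr (- _`_ _); lia.
Qed.

End Symmetric.
End Spectrum.

(** * Adjacency matrices *)

Section Graph.
Variables (R : rcfType) (V : finType) (G : sgraph V).
Local Notation n := #|V|.
Local Notation A := (adjacency_matrix R G).
Local Notation l j := (lambda R G j.+1).

Lemma adjacency_matrix_sym : A^T = A.
Proof. by apply/matrixP => i j; rewrite !mxE adj_sym. Qed.

Lemma lambda_decreasing i j : (i <= j < n)%N -> l j <= l i.
Proof. exact/eigenvalues_decreasing/adjacency_matrix_sym. Qed.

Lemma sum_lambda : \sum_(j < n) l j = 0.
Proof.
have := sum_eigenvalues adjacency_matrix_sym.
rewrite (big_nth 0) big_mkord size_eigenvalues ?adjacency_matrix_sym // => ->.
by rewrite /mxtrace big1 // => i _; rewrite mxE adj_irrefl.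
Qed.

Lemma lambda_bound j : (j < n)%N -> `|l j| <= lambda R G 1.
Proof.
move=> lt_jn; apply: nonneg_eigenvalue_bound; first exact: adjacency_matrix_sym.
  by move=> i k; rewrite mxE ler0n.
by rewrite mem_nth // size_eigenvalues // adjacency_matrix_sym.
Qed.

(** Conjugation by the diagonal matrix of signs telling the two sides apart
    changes the sign of every entry of [A] that joins the two sides, that is,
    of every nonzero entry. *)
Lemma bipartite_char_polyN : bipartite G -> char_poly (- A) = char_poly A.
Proof.
case=> S bipG; pose d : 'rV[R]_n := \row_i (-1) ^+ (enum_val i \in S).
have dd : diag_mx d *m diag_mx d = 1%:M.
  apply/matrixP => i j; rewrite mul_diag_mx !mxE.
  by case: eqP => _; rewrite ?mulr0n ?mulr0 // !mulr1n -expr2 sqrr_sign.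
have [d_unit _] := mulmx1_unit dd.
have -> : - A = invmx (diag_mx d) *m A *m diag_mx d.
  have -> : invmx (diag_mx d) = diag_mx d.
    by rewrite -[LHS]mulmx1 -dd mulmxA mulVmx // mul1mx.
  apply/matrixP => i j; rewrite mul_mx_diag mul_diag_mx !mxE mulrAC -signr_addb.
  case: (boolP (G _ _)) => [/bipG|_]; last by rewrite mulr0 oppr0.
  by rewrite mulr1 -negb_eqb => ->; rewrite expr1.
exact: char_poly_similar.
Qed.

(** For odd [n] the two sums differ by the middle eigenvalue, so their minimum
    is the first one plus the minimum of [0] and that eigenvalue; for even [n]
    they coincide. *)
Lemma betaE : (1 < n)%N -> beta R G *+ n./2 =
  Num.min (\sum_(j < n./2) l j) (\sum_(j < n - n./2) l j).
Proof.
move=> n_gt1; have m_gt0 : (0 < n./2)%N by lia.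
have n2 := odd_double_half n.
have m_neq0 : n./2%:R != 0 :> R by rewrite pnatr_eq0; lia.
rewrite /beta -mulr_natr; case: ifP => odd_n.
  have [-> ->] : (n - 1 = n./2 * 2)%N /\ (n - n./2 = n./2.+1)%N by lia.
  have [-> ->] : ((n./2 * 2)./2 = n./2)%N /\ ((n + 1)./2 = n./2.+1)%N by lia.
  rewrite big_add1 /= big_mkord big_ord_recr /=.
  rewrite -[X in _ = Num.min X _]addr0 -addr_minr natrM.
  by field.
have -> : n%:R = n./2%:R * 2 :> R by rewrite -natrM; congr (_%:R); lia.
have -> : (n - n./2 = n./2)%N by lia.
by rewrite minxx big_add1 /= big_mkord; field.
Qed.

Lemma lambda_antisymmetric j : bipartite G -> (j < n)%N ->
  lambda R G (n - j.+1).+1 = - l j.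
Proof.
move=> bipG; apply: eigenvalues_antisymmetric; first exact: adjacency_matrix_sym.
exact: bipartite_char_polyN.
Qed.

Lemma energyE : bipartite G ->
  energy R G = \sum_(j < n./2) l j + \sum_(j < n - n./2) l j.
Proof.
move=> bipG; rewrite /energy big_add1 /= big_mkord.
apply: (antisymmetric_sum_norm (f := fun j => l j)); first exact: lambda_decreasing.
by move=> j; apply: lambda_antisymmetric.
Qed.

End Graph.

Unset Implicit Arguments.

Theorem lemma2p4 (R : rcfType) (V : finType) (G : sgraph V)
    (n_ge2 : (2 <= #|V|)%N) :
  [/\ majorized (beta R G *: sign_vector R #|V|) (lambda_vector R G),
      majorized (lambda_vector R G) (lambda R G 1 *: sign_vector R #|V|)
    & bipartite G ->
      [/\ beta R G = 1 / (2 * #|V|./2)%:R * energy R G,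
          majorized ((energy R G / (2 * #|V|./2)%:R) *: sign_vector R #|V|)
                    (lambda_vector R G)
        & majorized (lambda_vector R G)
                    (lambda R G 1 *: sign_vector R #|V|)]].
Proof.
have lam_dec := @lambda_decreasing R V G.
have lam_sum := sum_lambda R G.
have lower : majorized (beta R G *: sign_vector R #|V|) (lambda_vector R G).
  exact: sign_vector_majorized n_ge2 lam_dec lam_sum (betaE R G n_ge2).
have upper : majorized (lambda_vector R G) (lambda R G 1 *: sign_vector R #|V|).
  apply: majorized_sign_vector lam_dec lam_sum _ (@lambda_bound R V G).
  exact: le_trans (normr_ge0 _) (lambda_bound R G (ltnW n_ge2)).
split=> // bipG.
suff betaE' : beta R G = energy R G / (2 * #|V|./2)%:R.
  by split=> //; rewrite -?betaE' // mul1r mulrC.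
have lam_mirror : \sum_(j < #|V| - #|V|./2) lambda R G j.+1 =
    \sum_(j < #|V|./2) lambda R G j.+1.
  apply: (antisymmetric_prefix (f := fun j => lambda R G j.+1)) lam_sum _; last by lia.
  by move=> j; apply: lambda_antisymmetric.
have := betaE R G n_ge2; rewrite energyE // lam_mirror.
rewrite minxx -mulr_natr -mulr2n -[_ *+ 2]mulr_natl natrM => <-.
have m_neq0 : #|V|./2%:R != 0 :> R by rewrite pnatr_eq0; lia.
by field.
Qed.
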